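(* Let $\mathcal{N}=((R,\vee,\cdot,0,1),(R,\wedge,\ast,1,0),\alpha)$ be a coupled right orthosemiring. Then $\mathbf{N}(\mathbf{L}(\mathcal{N}))=\mathcal{N}$.
   Context: An orthomodular lattice is an algebra $\mathcal{L}=(L,\vee,\wedge,',0,1)$ of type $(2,2,1,0,0)$ such that: (i) $(L,\vee,\wedge,0,1)$ is a bounded lattice (with least element $0$ and greatest element $1$); (ii) $x\le y$ implies $x'\ge y'$; (iii) $(x')'=x$; (iv) $x\le y$ implies $y=x\vee(y\wedge x')$. A right near semiring is an algebra $(R,+,\cdot,0,1)$ of type $(2,2,0,0)$ such that: (i) $(R,+,0)$ is a commutative monoid; (ii) $(R,\cdot)$ is a groupoid (a set with a binary operation, not necessarily associative) with two-sided neutral element $1$; (iii) $(x+y)z=xz+yz$ for all $x,y,z\in R$; (iv) $x0=0x=0$ for all $x\in R$. In a tuple $(R,\wedge,\ast,1,0)$ the additive operation is $\wedge$ with neutral element $1$, the multiplicative operation is $\ast$ with neutral element $0$, and the absorbing element in (iv) is $1$. A right near semiring $(R,+,\cdot,0,1)$ is $\vee$-semilattice ordered if there is a join-semilattice operation $\vee$ on $R$ such that $x+y=x\vee y$ and $xy\le y$ for all $x,y\in R$, with respect to the induced order ($x\le y$ iff $x\vee y=y$). It is $\wedge$-semilattice ordered if there is a meet-semilattice operation $\wedge$ on $R$ such that $x+y=x\wedge y$ and $xy\ge y$ for all $x,y\in R$, with respect to the induced order ($x\le y$ iff $x\wedge y=x$). A coupled right orthosemiring is an ordered triple $((R,\vee,\cdot,0,1),(R,\wedge,\ast,1,0),\alpha)$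 such that: (R1) $(R,\vee,\wedge)$ is a lattice; (R2) $(R,\vee,\cdot,0,1)$ is a $\vee$-semilattice ordered right near semiring; (R3) $(R,\wedge,\ast,1,0)$ is a $\wedge$-semilattice ordered right near semiring; (R4) $\alpha$ is an involutive isomorphism between $(R,\vee,\cdot,0,1)$ and $(R,\wedge,\ast,1,0)$, i.e. $\alpha:R\to R$ satisfies $\alpha(\alpha(x))=x$, $\alpha(x\vee y)=\alpha(x)\wedge\alpha(y)$, $\alpha(xy)=\alpha(x)\ast\alpha(y)$ for all $x,y\in R$, and $\alpha(0)=1$, $\alpha(1)=0$; (R5) $(x\wedge\alpha(y))\vee y=x\ast y$ for all $x,y\in R$; (R6) $y\ast(x\wedge y)=y$ for all $x,y\in R$. For an orthomodular lattice $\mathcal{L}=(L,\vee,\wedge,',0,1)$, put $x\oplus y:=(x\wedge y')\vee y$ and $x\odot y:=(x\vee y')\wedge y$ for $x,y\in L$, and let $\mathbf{N}(\mathcal{L}):=((L,\vee,\odot,0,1),(L,\wedge,\oplus,1,0),{}')$; this is a coupled right orthosemiring. For a coupled right orthosemiring $\mathcal{N}=((R,\vee,\cdot,0,1),(R,\wedge,\ast,1,0),\alpha)$, let $\mathbf{L}(\mathcal{N}):=(R,\vee,\wedge,\alpha,0,1)$; this is an orthomodular lattice. *)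

(* Defs.v *)
From mathcomp Require Import ssreflect ssrbool ssrfun.

Set Implicit Arguments.
Unset Strict Implicit.
Unset Printing Implicit Defensive.

(* Carriers are arbitrary types (no decidable equality or choice) and the
   theory compares tuples of operations on one fixed carrier, so algebras are
   plain records of operations rather than order.v structures. *)

Record is_semilattice (R : Type) (op : R -> R -> R) : Prop := IsSemilattice {
  semilatA : associative op;
  semilatC : commutative op;
  semilatI : idempotent_op op
}.

Record is_lattice (R : Type) (join meet : R -> R -> R) : Prop := IsLattice {
  latUA : associative join;
  latUC : commutative join;
  latIA : associative meet;
  latIC : commutative meet;
  latUK : forall x y, join x (meet x y) = x;
  latIK : forall x y, meet x (join x y) = x
}.

Definition join_le (R : Type) (join : R -> R -> R) (x y : R) : Prop :=
  join x y = y.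

Definition meet_le (R : Type) (meet : R -> R -> R) (x y : R) : Prop :=
  meet x y = x.

Record ortho_alg (R : Type) : Type := OrthoAlg {
  oa_join : R -> R -> R;
  oa_meet : R -> R -> R;
  oa_compl : R -> R;
  oa_bot : R;
  oa_top : R
}.

Definition oa_le (R : Type) (L : ortho_alg R) : R -> R -> Prop :=
  join_le (oa_join L).

Record is_orthomodular (R : Type) (L : ortho_alg R) : Prop := IsOrthomodular {
  oml_lattice : is_lattice (oa_join L) (oa_meet L);
  oml_bot_le : forall x, oa_le L (oa_bot L) x;
  oml_le_top : forall x, oa_le L x (oa_top L);
  oml_antitone : forall x y,
    oa_le L x y -> oa_le L (oa_compl L y) (oa_compl L x);
  oml_complK : involutive (oa_compl L);
  oml_modular : forall x y,
    oa_le L x y -> y = oa_join L x (oa_meet L y (oa_compl L x))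
}.

Record orthomodular_lattice (R : Type) : Type := OrthomodularLattice {
  oml_alg :> ortho_alg R;
  oml_axioms : is_orthomodular oml_alg
}.

Record ns_alg (R : Type) : Type := NsAlg {
  ns_add : R -> R -> R;
  ns_mul : R -> R -> R;
  ns_zero : R;
  ns_one : R
}.

Record is_right_near_semiring (R : Type) (S : ns_alg R) : Prop :=
  IsRightNearSemiring {
  ns_addA : associative (ns_add S);
  ns_addC : commutative (ns_add S);
  ns_add0 : left_id (ns_zero S) (ns_add S);
  ns_mul1l : left_id (ns_one S) (ns_mul S);
  ns_mul1r : right_id (ns_one S) (ns_mul S);
  ns_mulDl : left_distributive (ns_mul S) (ns_add S);
  ns_mul0l : left_zero (ns_zero S) (ns_mul S);
  ns_mul0r : right_zero (ns_zero S) (ns_mul S)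
}.

Definition join_semilattice_ordered (R : Type) (S : ns_alg R) : Prop :=
  exists join : R -> R -> R,
    [/\ is_semilattice join,
        forall x y, ns_add S x y = join x y
      & forall x y, join_le join (ns_mul S x y) y].

Definition meet_semilattice_ordered (R : Type) (S : ns_alg R) : Prop :=
  exists meet : R -> R -> R,
    [/\ is_semilattice meet,
        forall x y, ns_add S x y = meet x y
      & forall x y, meet_le meet y (ns_mul S x y)].

(* [ca_fst] is (R, \/, ., 0, 1) and [ca_snd] is (R, /\, *, 1, 0): the lattice
   join and meet are the additions of the two components. *)
Record coupled_alg (R : Type) : Type := CoupledAlg {
  ca_fst : ns_alg R;
  ca_snd : ns_alg R;
  ca_inv : R -> R
}.

Definition ca_join (R : Type) (N : coupled_alg R) := ns_add (ca_fst N).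
Definition ca_mul (R : Type) (N : coupled_alg R) := ns_mul (ca_fst N).
Definition ca_zero (R : Type) (N : coupled_alg R) := ns_zero (ca_fst N).
Definition ca_one (R : Type) (N : coupled_alg R) := ns_one (ca_fst N).
Definition ca_meet (R : Type) (N : coupled_alg R) := ns_add (ca_snd N).
Definition ca_star (R : Type) (N : coupled_alg R) := ns_mul (ca_snd N).

(* [cro_snd_zero] and [cro_snd_one] say that the two components share their
   constants, with swapped roles. *)
Record is_coupled_right_orthosemiring (R : Type) (N : coupled_alg R) : Prop :=
  IsCoupledRightOrthosemiring {
  cro_snd_zero : ns_zero (ca_snd N) = ca_one N;
  cro_snd_one : ns_one (ca_snd N) = ca_zero N;
  cro_lattice : is_lattice (ca_join N) (ca_meet N);
  cro_fst_semiring : is_right_near_semiring (ca_fst N);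
  cro_fst_ordered : join_semilattice_ordered (ca_fst N);
  cro_snd_semiring : is_right_near_semiring (ca_snd N);
  cro_snd_ordered : meet_semilattice_ordered (ca_snd N);
  cro_invK : involutive (ca_inv N);
  cro_inv_join : forall x y,
    ca_inv N (ca_join N x y) = ca_meet N (ca_inv N x) (ca_inv N y);
  cro_inv_mul : forall x y,
    ca_inv N (ca_mul N x y) = ca_star N (ca_inv N x) (ca_inv N y);
  cro_inv_zero : ca_inv N (ca_zero N) = ca_one N;
  cro_inv_one : ca_inv N (ca_one N) = ca_zero N;
  cro_starE : forall x y,
    ca_join N (ca_meet N x (ca_inv N y)) y = ca_star N x y;
  cro_star_meet : forall x y, ca_star N y (ca_meet N x y) = y
}.

Record coupled_right_orthosemiring (R : Type) : Type :=
  CoupledRightOrthosemiring {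
  cro_alg :> coupled_alg R;
  cro_axioms : is_coupled_right_orthosemiring cro_alg
}.

Definition ortho_oplus (R : Type) (L : ortho_alg R) (x y : R) : R :=
  oa_join L (oa_meet L x (oa_compl L y)) y.

Definition ortho_odot (R : Type) (L : ortho_alg R) (x y : R) : R :=
  oa_meet L (oa_join L x (oa_compl L y)) y.

Definition coupled_alg_of (R : Type) (L : ortho_alg R) : coupled_alg R :=
  CoupledAlg
    (NsAlg (oa_join L) (ortho_odot L) (oa_bot L) (oa_top L))
    (NsAlg (oa_meet L) (ortho_oplus L) (oa_top L) (oa_bot L))
    (oa_compl L).

Definition ortho_alg_of (R : Type) (N : coupled_alg R) : ortho_alg R :=
  OrthoAlg (ca_join N) (ca_meet N) (ca_inv N) (ca_zero N) (ca_one N).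

Section LatticeFacts.
Variables (R : Type) (join meet : R -> R -> R).
Hypothesis latP : is_lattice join meet.

Lemma lat_joinI : idempotent_op join.
Proof. by move=> x; rewrite -{2}(latIK latP x x) (latUK latP). Qed.

Lemma lat_meetI : idempotent_op meet.
Proof. by move=> x; rewrite -{2}(latUK latP x x) (latIK latP). Qed.

Lemma lat_join_semilattice : is_semilattice join.
Proof. exact: IsSemilattice (latUA latP) (latUC latP) lat_joinI. Qed.

Lemma lat_meet_semilattice : is_semilattice meet.
Proof. exact: IsSemilattice (latIA latP) (latIC latP) lat_meetI. Qed.

Lemma lat_leP x y : join_le join x y <-> meet_le meet x y.
Proof.
rewrite /join_le /meet_le; split=> <-; first exact: latIK latP _ _.
by rewrite (latUC latP) (latIC latP) (latUK latP).
Qed.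

Lemma lat_le_trans y x z :
  join_le join x y -> join_le join y z -> join_le join x z.
Proof. by rewrite /join_le => xy yz; rewrite -yz (latUA latP) xy. Qed.

Lemma lat_le_anti x y : join_le join x y -> join_le join y x -> x = y.
Proof. by rewrite /join_le => xy yx; rewrite -yx (latUC latP). Qed.

Lemma lat_leUl x y : join_le join x (join x y).
Proof. by rewrite /join_le (latUA latP) lat_joinI. Qed.

Lemma lat_leUr x y : join_le join y (join x y).
Proof. rewrite (latUC latP); exact: lat_leUl. Qed.

Lemma lat_leU x y z :
  join_le join x z -> join_le join y z -> join_le join (join x y) z.
Proof. by rewrite /join_le => xz yz; rewrite -(latUA latP) yz xz. Qed.

Lemma lat_geIl x y : join_le join (meet x y) x.
Proof. by rewrite /join_le (latUC latP) (latUK latP). Qed.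

Lemma lat_geIr x y : join_le join (meet x y) y.
Proof. rewrite (latIC latP); exact: lat_geIl. Qed.

Lemma lat_leI x y z :
  join_le join z x -> join_le join z y -> join_le join z (meet x y).
Proof.
move=> /lat_leP zx /lat_leP zy; apply/lat_leP.
by move: zx zy; rewrite /meet_le (latIA latP) => -> ->.
Qed.

End LatticeFacts.

Section OrthomodularFacts.
Variables (R : Type) (L : ortho_alg R).
Hypothesis omlP : is_orthomodular L.

Local Notation "x \v y" := (oa_join L x y) (at level 50, left associativity).
Local Notation "x \w y" := (oa_meet L x y) (at level 40, left associativity).
Local Notation "x '^o'" := (oa_compl L x) (at level 2, format "x '^o'").
Local Notation le := (oa_le L).
Local Notation latP := (oml_lattice omlP).
Local Notation complK := (oml_complK omlP).

Lemma oml_le_compl x y : le x (y^o) -> le y (x^o).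
Proof. by move=> /(oml_antitone omlP); rewrite complK. Qed.

Lemma oml_complU x y : (x \v y)^o = x^o \w y^o.
Proof.
apply: (lat_le_anti latP).
  by apply: (lat_leI latP); apply: (oml_antitone omlP);
    [apply: (lat_leUl latP) | apply: (lat_leUr latP)].
apply: oml_le_compl; apply: (lat_leU latP); apply: oml_le_compl.
  exact: lat_geIl latP _ _.
exact: lat_geIr latP _ _.
Qed.

Lemma oml_complI x y : (x \w y)^o = x^o \v y^o.
Proof. by rewrite -[RHS]complK oml_complU !complK. Qed.

Lemma oml_compl_bot : (oa_bot L)^o = oa_top L.
Proof.
apply: (lat_le_anti latP); first exact: oml_le_top.
apply: oml_le_compl; exact: oml_bot_le.
Qed.

Lemma oml_compl_top : (oa_top L)^o = oa_bot L.
Proof. by rewrite -oml_compl_bot complK. Qed.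

Lemma oml_join0 x : oa_bot L \v x = x.
Proof. exact: oml_bot_le omlP x. Qed.

Lemma oml_meet1 x : oa_top L \w x = x.
Proof. by rewrite (latIC latP); apply/(lat_leP latP); apply: oml_le_top. Qed.

Lemma oml_join1 x : oa_top L \v x = oa_top L.
Proof. by rewrite (latUC latP); apply: (oml_le_top omlP). Qed.

Lemma oml_meet0 x : oa_bot L \w x = oa_bot L.
Proof. by apply/(lat_leP latP); apply: oml_bot_le. Qed.

Lemma oml_join_compl x : x \v x^o = oa_top L.
Proof. by rewrite [RHS](oml_modular omlP (oml_le_top omlP x)) oml_meet1. Qed.

Lemma oml_meet_compl x : x \w x^o = oa_bot L.
Proof.
by rewrite -oml_compl_top -(oml_join_compl x) oml_complU complK (latIC latP).
Qed.

Lemma oml_modular_dual x y : le x y -> x = y \w (x \v y^o).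
Proof.
move=> /(oml_antitone omlP) /(oml_modular omlP) xy.
by rewrite -[LHS]complK {1}xy oml_complU oml_complI !complK.
Qed.

Lemma oml_odot_adjoint x z w :
  le (ortho_odot L x z) w <-> le x (z^o \v (z \w w)).
Proof.
rewrite /ortho_odot; split=> h.
  have /(oml_modular omlP) e := lat_leUr latP x (z^o).
  apply: (lat_le_trans latP (lat_leUl latP x (z^o))).
  rewrite e complK; apply: (lat_leU latP); first exact: lat_leUl latP _ _.
  apply: (lat_le_trans latP _ (lat_leUr latP _ _)).
  by apply: (lat_leI latP) => //; apply: (lat_geIr latP).
apply: (lat_le_trans latP _ (lat_geIr latP z w)).
rewrite (oml_modular_dual (lat_geIl latP z w)).
apply: (lat_leI latP); first exact: lat_geIr latP _ _.
apply: (lat_le_trans latP (lat_geIl latP _ _)).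
rewrite (latUC latP (z \w w)).
by apply: (lat_leU latP) => //; apply: (lat_leUl latP).
Qed.

Lemma oml_odotDl : left_distributive (ortho_odot L) (oa_join L).
Proof.
move=> x y z; apply: (lat_le_anti latP).
  apply/oml_odot_adjoint; apply: (lat_leU latP); apply/oml_odot_adjoint.
    exact: lat_leUl latP _ _.
  exact: lat_leUr latP _ _.
have /oml_odot_adjoint h :
    le (ortho_odot L (x \v y) z) (ortho_odot L (x \v y) z).
  exact: lat_joinI latP _.
apply: (lat_leU latP); apply/oml_odot_adjoint.
  exact: (lat_le_trans latP (lat_leUl latP x y) h).
exact: (lat_le_trans latP (lat_leUr latP x y) h).
Qed.

Lemma oml_compl_odot x y :
  (ortho_odot L x y)^o = ortho_oplus L (x^o) (y^o).
Proof. by rewrite /ortho_odot oml_complI oml_complU. Qed.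

Lemma oml_compl_oplus x y :
  (ortho_oplus L x y)^o = ortho_odot L (x^o) (y^o).
Proof. by rewrite /ortho_oplus oml_complU oml_complI. Qed.

Lemma oml_oplusDl : left_distributive (ortho_oplus L) (oa_meet L).
Proof.
move=> x y z; rewrite -[LHS]complK oml_compl_oplus oml_complI oml_odotDl.
by rewrite oml_complU !oml_compl_odot !complK.
Qed.

Lemma coupled_alg_ofP : is_coupled_right_orthosemiring (coupled_alg_of L).
Proof.
have odot1l : left_id (oa_top L) (ortho_odot L).
  by move=> x; rewrite /ortho_odot oml_join1 oml_meet1.
have odot1r : right_id (oa_top L) (ortho_odot L).
  move=> x; rewrite /ortho_odot oml_compl_top (latUC latP) oml_join0.
  by rewrite (latIC latP) oml_meet1.
have odot0l : left_zero (oa_bot L) (ortho_odot L).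
  by move=> x; rewrite /ortho_odot oml_join0 (latIC latP) oml_meet_compl.
have odot0r : right_zero (oa_bot L) (ortho_odot L).
  by move=> x; rewrite /ortho_odot (latIC latP) oml_meet0.
have oplusE x y : ortho_oplus L x y = (ortho_odot L (x^o) (y^o))^o.
  by rewrite oml_compl_odot !complK.
split=> //=; rewrite /ca_join /ca_meet /ca_mul /ca_star /ca_zero /ca_one /=.
- exact: latP.
- split=> //=; [exact: latUA latP | exact: latUC latP | exact: oml_join0
    | exact: oml_odotDl].
- exists (oa_join L); split=> //; first exact: lat_join_semilattice latP.
  by move=> x y; apply: (lat_geIr latP).
- split=> /=; [exact: latIA latP | exact: latIC latP | exact: oml_meet1
    | | | exact: oml_oplusDl | |] => x; rewrite oplusE ?oml_compl_bot
    ?oml_compl_top ?odot1l ?odot1r ?odot0l ?odot0r ?complK //;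
    exact: oml_compl_bot.
- exists (oa_meet L); split=> //; first exact: lat_meet_semilattice latP.
  by move=> x y; apply/(lat_leP latP); apply: (lat_leUr latP).
- exact: complK.
- exact: oml_complU.
- exact: oml_compl_odot.
- exact: oml_compl_bot.
- exact: oml_compl_top.
move=> x y; rewrite /ortho_oplus (latUC latP).
by rewrite -(oml_modular omlP) //; apply: (lat_geIr latP).
Qed.

End OrthomodularFacts.

Lemma ortho_alg_ofP (R : Type) (N : coupled_alg R) :
  is_coupled_right_orthosemiring N -> is_orthomodular (ortho_alg_of N).
Proof.
move=> NP; have latP := cro_lattice NP.
split=> //=; rewrite /oa_le /=.
- exact: ns_add0 (cro_fst_semiring NP).
- move=> x; apply/(lat_leP latP); rewrite /meet_le (latIC latP).
  rewrite -(cro_snd_zero NP); exact: ns_add0 (cro_snd_semiring NP) x.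
- move=> x y xy; apply/(lat_leP latP).
  by rewrite /meet_le (latIC latP) -(cro_inv_join NP) xy.
- exact: cro_invK NP.
move=> x y /(lat_leP latP) xy.
by rewrite (latUC latP) (cro_starE NP) -xy (cro_star_meet NP).
Qed.

Definition N_of (R : Type) (L : orthomodular_lattice R) :
    coupled_right_orthosemiring R :=
  CoupledRightOrthosemiring (coupled_alg_ofP (oml_axioms L)).

Definition L_of (R : Type) (N : coupled_right_orthosemiring R) :
    orthomodular_lattice R :=
  OrthomodularLattice (ortho_alg_ofP (cro_axioms N)).

(* Main.v *)
Require Import Defs.
From mathcomp Require Import ssreflect ssrbool ssrfun.
From Stdlib Require Import FunctionalExtensionality ProofIrrelevance.

(* The law x * y = (x /\ y') \/ y is axiom (R5), and the involution carries it
   over to the product of the first component. *)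

(** Join, meet, involution and the first component's constants survive the round trip by definition.
    Only the two products and the second component's constants need an argument; proof irrelevance
    then lifts equality of algebras to the bundled structures. *)

Lemma coupled_right_orthosemiring_inj (R : Type) :
  injective (@cro_alg R).
Proof.
move=> [A AP] [B BP] /= eAB; move: BP; rewrite -eAB => BP.
by rewrite (proof_irrelevance _ AP BP).
Qed.

Section OrthosemiringProducts.
Variables (R : Type) (N : coupled_alg R).
Hypothesis NP : is_coupled_right_orthosemiring N.

Lemma ortho_oplusE x y : ortho_oplus (ortho_alg_of N) x y = ca_star N x y.
Proof. exact: cro_starE. Qed.

Lemma ortho_odotE x y : ortho_odot (ortho_alg_of N) x y = ca_mul N x y.
Proof.
apply: (can_inj (cro_invK NP)); rewrite (cro_inv_mul NP) -ortho_oplusE.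
exact: (oml_compl_odot (ortho_alg_ofP NP)).
Qed.

Lemma coupled_alg_ofK : coupled_alg_of (ortho_alg_of N) = N.
Proof.
have odotE : ortho_odot (ortho_alg_of N) = ca_mul N.
  by do 2![apply: functional_extensionality => ?]; apply: ortho_odotE.
have oplusE : ortho_oplus (ortho_alg_of N) = ca_star N.
  by do 2![apply: functional_extensionality => ?]; apply: ortho_oplusE.
rewrite /coupled_alg_of odotE oplusE /=.
(* The rebuilt second component reuses the constants of the first, swapped; these axioms identify
   them with its own. *)
move: (cro_snd_zero NP) (cro_snd_one NP).
by case: (N) => [[? ? ? ?] [? ? ? ?] ?] /= -> ->.
Qed.

End OrthosemiringProducts.

Theorem theorem12 (R : Type) (N : coupled_right_orthosemiring R) :
  N_of (L_of N) = N.
Proof.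
exact/coupled_right_orthosemiring_inj/coupled_alg_ofK/cro_axioms.
Qed.
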